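(* Let $R$ be a real closed field, $A=R[x_1,\dots,x_n]$, $\delta\in\operatorname{Sper}(A)$, and let the coordinates be numbered so that, for some $p$ with $0\le p\le n$, $\nu_\delta(x_j)=0$ for $1\le j\le p$ and $\nu_\delta(x_j)>0$ for $j>p$. Let $\{1,\dots,p\}=I_\delta\coprod F_\delta\coprod G_\delta$ be the partition defined in the context, let $T$ be a set with $G_\delta\subset T\subset G_\delta\cup F_\delta$, and let $\delta^*=\psi(\delta)\in\operatorname{Sper}^*(B_T)$. The valuation $\nu_{\delta^*}$ of $B_T(\delta^* )$ associated to $\delta^*$ has the following properties: (1) $\nu_{\delta^*}(y_j)=0$ for $j\in F_\delta$; (2) $\nu_{\delta^*}(y_j)>0$ for $j\in I_\delta\cup G_\delta$; (3) there exists $q\in G_\delta$ and a strictly positive integer $N$ such that, for all $j\in I_\delta$, $$N\nu_{\delta^*}(y_q)>\nu_{\delta^*}(y_j).$$ In particular, if $I_\delta\ne\emptyset$ then $G_\delta\ne\emptyset$; (4) the valuation ring $R_\delta$ is the localization of $R_{\delta^*}$ at a prime ideal (where $A(\delta)$ is identified with $B_T(\delta^* )$ via the canonical isomorphism $\phi$); this gives rise to a surjective order-preserving group homomorphism $\tilde\phi:\Gamma_{\delta^*}\to\Gamma_\delta$ whose kernel is an isolated subgroup; (5) for all $j\in\{1,\dots,n\}$, $\tilde\phi(\nu_{\delta^*}(y_j))=\nu_\delta(x_j)$; (6) for $j\in\{1,\dots,p\}$, $\nu_{\delta^*}(y_j)\in\ker(\tilde\phi)$. In particular, given any $j\in\{1,\dots,p\}$,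 $t\in\{p+1,\dots,n\}$ and $N'\in\mathbb{N}$, we have $N'\nu_{\delta^*}(y_j)<\nu_{\delta^*}(y_t)$; (7) assume that $\nu_\delta(x_{p+1}),\dots,\nu_\delta(x_n)$ are $\mathbb{Q}$-linearly independent; then $$(\nu_{\delta^*}(y_{p+1}),\dots,\nu_{\delta^*}(y_n))\underset{\circ}{\sim}(\nu_\delta(x_{p+1}),\dots,\nu_\delta(x_n)).$$
   Context: **Real spectrum.** For a commutative ring $B$ with 1, $\operatorname{Sper}B$ is the set of pairs $\alpha=(\mathfrak p_\alpha,\le_\alpha)$ with $\mathfrak p_\alpha$ a prime ideal of $B$ (the support) and $\le_\alpha$ a total (ring) ordering of $B/\mathfrak p_\alpha$, equivalently of its fraction field. Write $B[\alpha]=B/\mathfrak p_\alpha$ and $B(\alpha)$ for its field of fractions. $|f|_\alpha$ is the absolute value with respect to $\le_\alpha$. $\operatorname{Sper}B$ has the spectral topology, with basic open sets $\{\alpha : f_1(\alpha)>_\alpha0,\dots,f_k(\alpha)>_\alpha0\}$, $f_i\in B$, where $f(\alpha)$ is the image of $f$ in $B[\alpha]$. If $B$ is an $R$-algebra, $\alpha$ is finite if for each $y\in B[\alpha]$ there is $N\in R$ with $|y|_\alpha<_\alpha N$; $\operatorname{Sper}^*B$ is the set of finite points. **Associated valuation.** For $\alpha\in\operatorname{Sper}B$, $R_\alpha=\{x\in B(\alpha) : \exists z\in B[\alpha],\ |x|_\alpha\le_\alpha z\}$ is a valuation ring of $B(\alpha)$; $\nu_\alpha$ is the corresponding valuation (written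 additively), with value group $\Gamma_\alpha=B(\alpha)^\times/R_\alpha^\times$. For $f\in B$, $\nu_\alpha(f)$ means $\nu_\alpha(f\bmod\mathfrak p_\alpha)$, with $\nu_\alpha(f)=\infty$ (greater than every element of $\Gamma_\alpha$) if $f\in\mathfrak p_\alpha$. **The partition.** $R_{>0}$ is the set of strictly positive elements of $R$. For $j\in\{1,\dots,p\}$: $j\in I_\delta$ iff $|x_j|_\delta<_\delta\epsilon$ for all $\epsilon\in R_{>0}$; $j\in F_\delta$ iff there are $c_1,c_2\in R_{>0}$ with $c_1<_\delta|x_j|_\delta<_\delta c_2$; $j\in G_\delta$ iff $|x_j|_\delta>_\delta N$ for all $N\in R$. **The ring $B_T$ and the point $\delta^*$.** $B_T=R[y_1,\dots,y_n]$ with $y_j=x_j$ if $j\notin T$ and $y_j=1/x_j$ if $j\in T$. The natural isomorphism of localizations $A_{\prod_{j\in T}x_j}\cong(B_T)_{\prod_{j\in T}y_j}$ induces a homeomorphism $\psi$ from $\operatorname{Sper}(A)\setminus\{\prod_{j\in T}x_j=0\}=\operatorname{Sper}(A_{\prod_{j\in T}x_j})$ to $\operatorname{Sper}(B_T)\setminus\{\prod_{j\in T}y_j=0\}=\operatorname{Sper}((B_T)_{\prod_{j\in T}y_j})$. Explicitly, $\delta^*=\psi(\delta)$ has support the prime $\mathfrak p_{\delta^*}$ of $B_T$ with $\mathfrak p_\delta A_{\prod x_j}\cong\mathfrak p_{\delta^*}(B_T)_{\prod y_j}$; this gives a canonical isomorphism $\phi:A(\delta)\cong B_T(\delta^* )$,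 and $\le_{\delta^*}$ is transported from $\le_\delta$ via $\phi$. Since $G_\delta\subset T\subset G_\delta\cup F_\delta$, one has $x_j\notin\mathfrak p_\delta$ for $j\in T$ (so $\psi(\delta)$ is defined), and $\delta^*$ is a finite point of $\operatorname{Sper}(B_T)$. **The map $\tilde\phi$.** It is the homomorphism $B_T(\delta^* )^\times/R_{\delta^*}^\times\to A(\delta)^\times/R_\delta^\times$ induced by $\phi^{-1}$ and the inclusion $R_{\delta^*}\subset R_\delta$ (under the identification $\phi$). An isolated subgroup of an ordered group is a convex subgroup. **Equivalence of tuples.** For $\ell$-tuples of elements of ordered abelian groups, $(b_1,\dots,b_\ell)\underset{\circ}{\sim}(b'_1,\dots,b'_\ell)$ means that there is an isomorphism of ordered groups from the subgroup generated by the $b_j$ onto the subgroup generated by the $b'_j$ mapping $b_j$ to $b'_j$ for each $j$.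
   Formalization: In (3), the existence of q in G_δ and N is asserted only when I_δ ∪ G_δ is nonempty; if both are empty (e.g. n = p = 1, δ the point x_1 = 1) no q in G_δ exists and the claim as written is false. *)

(* Defs.v *)
From HB Require Import structures.
From mathcomp Require Import all_boot all_order all_algebra generic_quotient ring_quotient.
From mathcomp Require Import boolp.
From mathcomp Require Import mpoly.

Set Implicit Arguments.
Unset Strict Implicit.
Unset Printing Implicit Defensive.

Import Order.TTheory GRing.Theory Num.Theory.
Local Open Scope ring_scope.
Local Open Scope quotient_scope.

Lemma fraction_reprE (D : idomainType) (x : {fraction D}) :
  x * FracField.tofrac (frac (repr x)).2 = FracField.tofrac (frac (repr x)).1.
Proof.
rewrite -{1}[x]reprK; move: (repr x) => r; unlock FracField.tofrac.
rewrite -[LHS]FracField.pi_mul; apply/eqmodP.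
rewrite /= FracField.equivfE /FracField.mulf !numden_Ratio ?mulf_neq0 ?oner_neq0 ?denom_ratioP //.
by rewrite !mulr1 mulrC.
Qed.

Section ResidueDomain.
Variables (B : comNzRingType) (P : prime_idealr B).

Definition residue_dom : Type := {ideal_quot P}.
HB.instance Definition _ := GRing.ComNzRing.on residue_dom.

Let runit (x : residue_dom) : bool := `[< exists y, y * x = 1 >].
Let rinv (x : residue_dom) : residue_dom :=
  if pselect (exists y, y * x = 1) is left e then sval (cid e) else x.

Let rmulVr : {in runit, left_inverse 1 rinv *%R}.
Proof.
move=> x /asboolP xu; rewrite /rinv; case: pselect => // e.
exact: (svalP (cid e)).
Qed.

Let runitP (x y : residue_dom) : y * x = 1 -> runit x.
Proof. by move=> yx; apply/asboolP; exists y. Qed.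

Let rinv0id : {in [predC runit], rinv =1 id}.
Proof. by move=> x /asboolP xu; rewrite /rinv; case: pselect. Qed.

HB.instance Definition _ :=
  GRing.ComNzRing_hasMulInverse.Build residue_dom rmulVr runitP rinv0id.

Let rintegral : GRing.integral_domain_axiom residue_dom.
Proof. exact: Quotient.rquot_IdomainAxiom. Qed.

HB.instance Definition _ :=
  GRing.ComUnitRing_isIntegral.Build residue_dom rintegral.

Definition residue_field : Type := {fraction residue_dom}.
HB.instance Definition _ := GRing.Field.on residue_field.

Definition to_residue_dom : B -> residue_dom := \pi_({ideal_quot P}).

Let to_residue_domB : zmod_morphism to_residue_dom. Proof. exact: rmorphB. Qed.
Let to_residue_domM : monoid_morphism to_residue_dom.
Proof. by split; [exact: rmorph1 | exact: rmorphM]. Qed.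

HB.instance Definition _ :=
  GRing.isZmodMorphism.Build B residue_dom to_residue_dom to_residue_domB.
HB.instance Definition _ :=
  GRing.isMonoidMorphism.Build B residue_dom to_residue_dom to_residue_domM.

Definition residue_dom_field : residue_dom -> residue_field :=
  @FracField.tofrac residue_dom.

Let residue_dom_fieldB : zmod_morphism residue_dom_field. Proof. exact: rmorphB. Qed.
Let residue_dom_fieldM : monoid_morphism residue_dom_field.
Proof. by split; [exact: rmorph1 | exact: rmorphM]. Qed.

HB.instance Definition _ :=
  GRing.isZmodMorphism.Build residue_dom residue_field residue_dom_field residue_dom_fieldB.
HB.instance Definition _ :=
  GRing.isMonoidMorphism.Build residue_dom residue_field residue_dom_field residue_dom_fieldM.

Definition to_residue_field : B -> residue_field :=
  residue_dom_field \o to_residue_dom.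

Let to_residue_fieldB : zmod_morphism to_residue_field. Proof. exact: rmorphB. Qed.
Let to_residue_fieldM : monoid_morphism to_residue_field.
Proof. by split; [exact: rmorph1 | exact: rmorphM]. Qed.

HB.instance Definition _ :=
  GRing.isZmodMorphism.Build B residue_field to_residue_field to_residue_fieldB.
HB.instance Definition _ :=
  GRing.isMonoidMorphism.Build B residue_field to_residue_field to_residue_fieldM.

End ResidueDomain.

(** A point of the real spectrum: a prime ideal together with a total ring
    ordering of the fraction field of the quotient. *)
Record sper (B : comNzRingType) := Sper {
  supp : prime_idealr B;
  sper_le : rel (residue_field supp);
  sper_le_anti : antisymmetric sper_le;
  sper_le_trans : transitive sper_le;
  sper_le_total : total sper_le;
  sper_le_add : forall x y z, sper_le x y -> sper_le (x + z) (y + z);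
  sper_le_mul : forall x y, sper_le 0 x -> sper_le 0 y -> sper_le 0 (x * y)
}.

(** [sper_dom alpha] is B[alpha], [sper_field alpha] is B(alpha); the latter
    carries the ordering of alpha as its canonical order. *)
Definition sper_dom (B : comNzRingType) (alpha : sper B) : Type :=
  residue_dom (supp alpha).
HB.instance Definition _ (B : comNzRingType) (alpha : sper B) :=
  GRing.IntegralDomain.on (sper_dom alpha).

Definition sper_field (B : comNzRingType) (alpha : sper B) : Type :=
  residue_field (supp alpha).
HB.instance Definition _ (B : comNzRingType) (alpha : sper B) :=
  GRing.Field.on (sper_field alpha).

Section SperOrder.
Variables (B : comNzRingType) (alpha : sper B).
Local Notation K := (sper_field alpha).
Implicit Types x y z : K.

Let le : rel K := @sper_le B alpha.
Let lt x y := (y != x) && le x y.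
Let nrm x : K := if le 0 x then x else - x.

Let lexx x : le x x.
Proof. by have := @sper_le_total B alpha x x; rewrite orbb. Qed.

Let le0D x y : le 0 x -> le 0 y -> le 0 (x + y).
Proof.
move=> x0 y0; apply: (sper_le_trans y0).
by rewrite -{1}[y]add0r; apply: sper_le_add.
Qed.

Let le0M x y : le 0 x -> le 0 y -> le 0 (x * y).
Proof. exact: sper_le_mul. Qed.

Let le0_anti x : le 0 x -> le x 0 -> x = 0.
Proof. by move=> x0 x1; apply: (@sper_le_anti B alpha); apply/andP. Qed.

Let subr_ge0 x y : le 0 (y - x) = le x y.
Proof.
apply/idP/idP => h.
  by have := sper_le_add x h; rewrite add0r subrK.
by have := sper_le_add (- x) h; rewrite subrr.
Qed.

Let le0_total x : le 0 x || le x 0.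
Proof. exact: sper_le_total. Qed.

Let leN x : le 0 (- x) = le x 0.
Proof. by rewrite -(subr_ge0 x) add0r. Qed.

Let nrmN x : nrm (- x) = nrm x.
Proof.
rewrite /nrm leN opprK.
case x0: (le 0 x); case x1: (le x 0) => //.
  by rewrite (le0_anti x0 x1) oppr0.
by have := le0_total x; rewrite x0 x1.
Qed.

Let ge0_nrm x : le 0 x -> nrm x = x.
Proof. by rewrite /nrm => ->. Qed.

Let lt_def x y : lt x y = (y != x) && le x y.
Proof. by []. Qed.

HB.instance Definition _ := Num.IntegralDomain_isLeReal.Build K
  le0D le0M le0_anti subr_ge0 le0_total nrmN ge0_nrm lt_def.

Lemma sper_leE x y : (x <= y) = sper_le x y.
Proof. by []. Qed.

End SperOrder.

Section SperEval.
Variables (B : comNzRingType) (alpha : sper B).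

Definition sper_dom_field : sper_dom alpha -> sper_field alpha :=
  @residue_dom_field B (supp alpha).

Let sper_dom_fieldB : zmod_morphism sper_dom_field. Proof. exact: rmorphB. Qed.
Let sper_dom_fieldM : monoid_morphism sper_dom_field.
Proof. by split; [exact: rmorph1 | exact: rmorphM]. Qed.

HB.instance Definition _ :=
  GRing.isZmodMorphism.Build (sper_dom alpha) (sper_field alpha) sper_dom_field sper_dom_fieldB.
HB.instance Definition _ :=
  GRing.isMonoidMorphism.Build (sper_dom alpha) (sper_field alpha) sper_dom_field sper_dom_fieldM.

Definition sper_eval : B -> sper_field alpha := to_residue_field (supp alpha).

Let sper_evalB : zmod_morphism sper_eval. Proof. exact: rmorphB. Qed.
Let sper_evalM : monoid_morphism sper_eval.
Proof. by split; [exact: rmorph1 | exact: rmorphM]. Qed.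

HB.instance Definition _ :=
  GRing.isZmodMorphism.Build B (sper_field alpha) sper_eval sper_evalB.
HB.instance Definition _ :=
  GRing.isMonoidMorphism.Build B (sper_field alpha) sper_eval sper_evalM.

Lemma sper_eval_eq0 b : (sper_eval b == 0) = (b \in supp alpha).
Proof.
have -> : (sper_eval b == 0) = (to_residue_dom (supp alpha) b == 0).
  exact: tofrac_eq0.
rewrite -(rmorph0 (to_residue_dom (supp alpha))).
rewrite -[LHS]/(\pi_({ideal_quot (supp alpha)}) b == \pi 0).
by rewrite -Quotient.idealrBE subr0.
Qed.

End SperEval.

Definition sper_finite (R : numDomainType) (B : comAlgType R) (alpha : sper B) : Prop :=
  forall y : sper_dom alpha, exists N : R,
    `|sper_dom_field y| < sper_eval alpha N%:A.

Record valring (F : fieldType) := Valring {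
  valring_pred :> {pred F};
  valring_closed : subring_closed valring_pred;
  valring_total : forall x, (x \in valring_pred) || (x^-1 \in valring_pred)
}.

(** The value group F^* / V^* of a valuation ring V, written additively and
    ordered by: the class of x is <= the class of y iff y / x lies in V. *)
Section ValueGroup.
Variables (F : fieldType) (V : valring F).

Definition nonzero_elt : Type := {x : F | x != 0}.
HB.instance Definition _ := Choice.on nonzero_elt.
Implicit Types u v w : nonzero_elt.

Let V1 : 1 \in V. Proof. by case: (valring_closed V). Qed.
Let VM : {in V &, forall x y, x * y \in V}.
Proof. by case: (valring_closed V). Qed.

Definition val_le (u v : nonzero_elt) : bool := sval v / sval u \in V.
Definition val_equiv (u v : nonzero_elt) : bool := val_le u v && val_le v u.

Let val_lexx u : val_le u u.
Proof. by rewrite /val_le divff ?(svalP u). Qed.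

Let val_le_trans : transitive val_le.
Proof.
move=> v u w; rewrite /val_le => uv vw; have := VM vw uv.
by rewrite mulrA divfK ?(svalP v).
Qed.

Let val_equiv_class : equiv_class_of val_equiv.
Proof.
split=> [u|u v|v u w]; rewrite /val_equiv ?val_lexx //; first by rewrite andbC.
move=> /andP[uv vu] /andP[vw wv].
by rewrite (val_le_trans uv vw) (val_le_trans wv vu).
Qed.

Canonical val_equiv_equiv := EquivRelPack val_equiv_class.
Canonical val_equiv_encModRel := defaultEncModRel val_equiv.

Definition value_group : Type := {eq_quot val_equiv}.
HB.instance Definition _ : EqQuotient nonzero_elt val_equiv value_group :=
  EqQuotient.on value_group.
HB.instance Definition _ := Choice.on value_group.

Definition val_class (u : nonzero_elt) : value_group := \pi_value_group u.

Let val_classP u v : reflect (val_class u = val_class v) (val_equiv u v).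
Proof. exact: (iffP (eqmodP _ _ _)). Qed.

Let reprP u : val_equiv (repr (val_class u)) u.
Proof. by apply/val_classP; rewrite /val_class reprK. Qed.

Let one_nz : nonzero_elt := exist _ 1 (oner_neq0 F).
Let mul_nz u v : nonzero_elt :=
  exist _ (sval u * sval v) (mulf_neq0 (svalP u) (svalP v)).
Let inv_nz u : nonzero_elt :=
  exist _ (sval u)^-1 (etrans (congr1 negb (invr_eq0 _)) (svalP u)).

Let vzero : value_group := val_class one_nz.
Let vadd (a b : value_group) : value_group := val_class (mul_nz (repr a) (repr b)).
Let vopp (a : value_group) : value_group := val_class (inv_nz (repr a)).

Let mul_le u u' v v' :
  val_le u u' -> val_le v v' -> val_le (mul_nz u v) (mul_nz u' v').
Proof. by rewrite /val_le /= invfM mulrACA; exact: VM. Qed.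

Let inv_le u v : val_le u v -> val_le (inv_nz v) (inv_nz u).
Proof. by rewrite /val_le /= invrK mulrC. Qed.

Let pi_vadd u v : vadd (val_class u) (val_class v) = val_class (mul_nz u v).
Proof.
apply/val_classP; have /andP[u1 u2] := reprP u; have /andP[v1 v2] := reprP v.
by rewrite /val_equiv !mul_le.
Qed.

Let pi_vopp u : vopp (val_class u) = val_class (inv_nz u).
Proof.
by apply/val_classP; have /andP[u1 u2] := reprP u; rewrite /val_equiv !inv_le.
Qed.

Lemma val_classW (P : value_group -> Prop) : (forall u, P (val_class u)) -> forall a, P a.
Proof. by move=> h a; rewrite -(reprK a); apply: h. Qed.

Let vaddA : associative vadd.
Proof.
elim/val_classW=> u; elim/val_classW=> v; elim/val_classW=> w; rewrite !pi_vadd.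
by congr val_class; apply: val_inj; rewrite /= mulrA.
Qed.

Let vaddC : commutative vadd.
Proof.
elim/val_classW=> u; elim/val_classW=> v; rewrite !pi_vadd.
by congr val_class; apply: val_inj; rewrite /= mulrC.
Qed.

Let vadd0 : left_id vzero vadd.
Proof.
elim/val_classW=> u; rewrite !pi_vadd.
by congr val_class; apply: val_inj; rewrite /= mul1r.
Qed.

Let vaddN : left_inverse vzero vopp vadd.
Proof.
elim/val_classW=> u; rewrite pi_vopp pi_vadd.
by congr val_class; apply: val_inj; rewrite /= mulVf ?(svalP u).
Qed.

HB.instance Definition _ :=
  GRing.isZmodule.Build value_group vaddA vaddC vadd0 vaddN.

Let vle (a b : value_group) : bool := val_le (repr a) (repr b).
Let vlt (a b : value_group) : bool := (b != a) && vle a b.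

Let vlexx : reflexive vle. Proof. by move=> a; apply: val_lexx. Qed.

Let vle_anti : antisymmetric vle.
Proof. by move=> a b ab; rewrite -(reprK a) -(reprK b); apply/val_classP. Qed.

Let vle_trans : transitive vle.
Proof. by move=> b a c; apply: val_le_trans. Qed.

Let vle_total : total vle.
Proof.
move=> a b; rewrite /vle /val_le orbC.
by have := valring_total V (sval (repr a) / sval (repr b)); rewrite invfM invrK mulrC [_^-1 * _]mulrC.
Qed.

HB.instance Definition _ := Order.Le_isPOrder.Build ring_display value_group
  vlexx vle_anti vle_trans.
HB.instance Definition _ :=
  Order.POrder_isTotal.Build ring_display value_group vle_total.

Lemma val_classD u v :
  val_class u + val_class v =
  val_class (exist _ (sval u * sval v) (mulf_neq0 (svalP u) (svalP v))).
Proof. exact: pi_vadd. Qed.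

Lemma val_class_le u v : (val_class u <= val_class v) = (sval v / sval u \in V).
Proof.
have /andP[u1 u2] := reprP u; have /andP[v1 v2] := reprP v.
apply/idP/idP => [h|h]; first exact: val_le_trans u2 (val_le_trans h v1).
exact: val_le_trans u1 (val_le_trans h v2).
Qed.

(** The valuation, with values in the group augmented by [None] = infinity. *)
Definition valuation (x : F) : option value_group := omap val_class (insub x).

End ValueGroup.

Lemma value_group_leD (F : fieldType) (V : valring F) (a b c : value_group V) :
  a <= b -> a + c <= b + c.
Proof.
move: a b c; apply: val_classW => u; apply: val_classW => v; apply: val_classW => w.
rewrite !val_classD !val_class_le /= invfM mulrACA.
by rewrite divff ?mulr1 //; exact: (svalP w).
Qed.

Definition voo_lt (G : porderZmodType) (a b : option G) : bool :=
  match a, b with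
  | Some x, Some y => x < y
  | Some _, None => true
  | None, _ => false
  end.

(** Multiples k * a for k : nat; the value 0 * infinity := infinity is junk. *)
Definition voo_muln (G : porderZmodType) (k : nat) (a : option G) : option G :=
  omap (fun x => x *+ k) a.

Section SperValuation.
Variables (B : comNzRingType) (alpha : sper B).

Definition sper_valring_pred : {pred sper_field alpha} :=
  fun x => `[< exists z : sper_dom alpha, `|x| <= sper_dom_field z >].

Lemma sper_valring_closed : subring_closed sper_valring_pred.
Proof.
split.
- by apply/asboolP; exists 1; rewrite normr1 rmorph1.
- move=> x y /asboolP[z xz] /asboolP[w yw]; apply/asboolP; exists (z + w).
  by rewrite rmorphD (le_trans (ler_normB _ _)) // lerD.
- move=> x y /asboolP[z xz] /asboolP[w yw]; apply/asboolP; exists (z * w).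
  by rewrite rmorphM normrM ler_pM.
Qed.

Lemma sper_valring_total x :
  (x \in sper_valring_pred) || (x^-1 \in sper_valring_pred).
Proof.
case: (lerP `|x| 1) => x1; apply/orP; [left|right]; apply/asboolP; exists 1;
  rewrite rmorph1 // normfV invf_le1 ?ltW //.
exact: lt_trans ltr01 x1.
Qed.

Definition sper_valring : valring (sper_field alpha) :=
  Valring sper_valring_closed sper_valring_total.

Definition sper_value_group : Type := value_group sper_valring.
HB.instance Definition _ := GRing.Zmodule.on sper_value_group.
HB.instance Definition _ := Order.Total.on sper_value_group.

Definition nu (f : B) : option sper_value_group :=
  valuation sper_valring (sper_eval alpha f).

End SperValuation.

(** The point of Sper B cut out by a ring morphism from B to an ordered field
    K: the support is the kernel, and the residue field B(alpha), which embeds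
    into K by [residue_emb], is ordered by transport along this embedding. *)
Section Kernel.
Variables (B : comNzRingType) (K : fieldType) (f : {rmorphism B -> K}).

Definition kernel : {pred B} := fun b => f b == 0.

Lemma kernelE b : (b \in kernel) = (f b == 0). Proof. by []. Qed.

Let kernel_closed : idealr_closed kernel.
Proof.
split; rewrite ?kernelE ?rmorph0 ?rmorph1 ?oner_eq0 //.
by move=> a u v /eqP fu /eqP fv; rewrite kernelE rmorphD rmorphM fu fv mulr0 addr0.
Qed.

Let kernel_prime : prime_idealr_closed kernel.
Proof. by move=> u v; rewrite !kernelE rmorphM mulf_eq0. Qed.

HB.instance Definition _ := isIdealr.Build B kernel kernel_closed.
HB.instance Definition _ := isPrimeIdealrClosed.Build B kernel kernel_prime.

Definition kernel_ideal : prime_idealr B := kernel.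

Local Notation D := (residue_dom kernel_ideal).
Local Notation F := (residue_field kernel_ideal).

Definition residue_dom_emb (x : D) : K :=
  f (repr (x : {ideal_quot kernel_ideal})).

End Kernel.

HB.lock Definition residue_emb (B : comNzRingType) (K : fieldType)
    (f : {rmorphism B -> K}) (x : residue_field (kernel_ideal f)) : K :=
  let r := repr (x : {fraction (residue_dom (kernel_ideal f))}) in
  residue_dom_emb (frac r).1 / residue_dom_emb (frac r).2.

Section KernelTheory.
Variables (B : comNzRingType) (K : fieldType) (f : {rmorphism B -> K}).
Local Notation kernel_ideal := (kernel_ideal f).
Local Notation D := (residue_dom kernel_ideal).
Local Notation F := (residue_field kernel_ideal).
Local Notation fbar := (@residue_dom_emb B K f).
Local Notation residue_emb := (@residue_emb B K f).

Let fbar_pi b : fbar (to_residue_dom kernel_ideal b) = f b.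
Proof.
apply/eqP; rewrite /residue_dom_emb -subr_eq0 -rmorphB.
have := Quotient.idealrBE kernel_ideal
  (repr (to_residue_dom kernel_ideal b : {ideal_quot kernel_ideal})) b.
by rewrite reprK eqxx.
Qed.

Let domW (P : D -> Prop) : (forall b, P (to_residue_dom kernel_ideal b)) ->
  forall x, P x.
Proof. by move=> h x; rewrite -[x](reprK (x : {ideal_quot kernel_ideal})); apply: h. Qed.

Let fbarB : zmod_morphism fbar.
Proof.
move=> x y; elim/domW: x => a; elim/domW: y => b.
by rewrite -rmorphB !fbar_pi rmorphB.
Qed.

Let fbarM : monoid_morphism fbar.
Proof.
split; first by rewrite -(rmorph1 (to_residue_dom kernel_ideal)) fbar_pi rmorph1.
move=> x y; elim/domW: x => a; elim/domW: y => b.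
by rewrite -rmorphM !fbar_pi rmorphM.
Qed.

HB.instance Definition _ := GRing.isZmodMorphism.Build D K fbar fbarB.
HB.instance Definition _ := GRing.isMonoidMorphism.Build D K fbar fbarM.

Let fbar_inj : injective fbar.
Proof.
have inj0 : forall x, fbar x = 0 -> x = 0; last first.
  by move=> x y xy; apply/subr0_eq/inj0; rewrite fbarB xy subrr.
elim/domW=> a; rewrite fbar_pi => fa0.
apply/eqP; rewrite -(rmorph0 (to_residue_dom kernel_ideal)).
rewrite -[_ == _]/(\pi_({ideal_quot kernel_ideal}) a == \pi 0).
by rewrite -Quotient.idealrBE subr0 kernelE; apply/eqP.
Qed.

Let fraction_repr (x : F) (n := (frac (repr (x : {fraction D}))).1)
  (d := (frac (repr (x : {fraction D}))).2) :
  d != 0 /\ x * residue_dom_field d = residue_dom_field n.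
Proof.
by split; [exact: denom_ratioP | exact: fraction_reprE].
Qed.

Let fbar_eq0 d : (fbar d == 0) = (d == 0).
Proof. by rewrite -(inj_eq fbar_inj) rmorph0. Qed.

Let toF (a : D) : F := residue_dom_field a.

Let toFM a b : toF (a * b) = toF a * toF b. Proof. exact: rmorphM. Qed.

Let toFD a b : toF (a + b) = toF a + toF b. Proof. exact: rmorphD. Qed.

Let toF_neq0 a : a != 0 -> toF a != 0.
Proof. by move=> a0; rewrite tofrac_eq0. Qed.

Let residue_emb_frac (a b : D) : b != 0 ->
  residue_emb (toF a / toF b) = fbar a / fbar b.
Proof.
move=> b0; have [] := fraction_repr (toF a / toF b).
rewrite residue_emb.unlock /=; set n := (_).1; set d := (_).2 => d0 xE.
have adE : a * d = n * b.
  have : toF (a * d) = toF (n * b).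
    by rewrite !toFM -[toF n]xE mulrAC divfK ?toF_neq0.
  by move/eqP; rewrite tofrac_eq => /eqP.
apply/eqP; rewrite eqr_div ?fbar_eq0 //.
by rewrite -!fbarM.2 -adE mulrC.
Qed.

Let fracW (P : F -> Prop) :
  (forall a b, b != 0 -> P (toF a / toF b)) -> forall x, P x.
Proof.
move=> h x; have [d0 xE] := fraction_repr x.
by rewrite -[x](mulfK (toF_neq0 d0)) [x * _]xE; apply: h.
Qed.

Let residue_embB : zmod_morphism residue_emb.
Proof.
move=> x y; elim/fracW: x => a b b0; elim/fracW: y => c d d0.
have dE : toF a / toF b - toF c / toF d = toF (a * d - c * b) / toF (b * d).
  rewrite toFD -[- (toF c / _)]mulNr -[- (c * b)]mulNr !toFM [toF (- c)]rmorphN.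
  by rewrite addf_div ?toF_neq0.
rewrite dE !residue_emb_frac ?mulf_neq0 // fbarB !fbarM.2.
by rewrite -[- (fbar c / _)]mulNr addf_div ?fbar_eq0 // mulNr.
Qed.

Let residue_embM : monoid_morphism residue_emb.
Proof.
split.
  have -> : 1 = toF 1 / toF 1 by rewrite divff ?toF_neq0 ?oner_neq0.
  by rewrite residue_emb_frac ?oner_neq0 // divff ?fbar_eq0 ?oner_neq0.
move=> x y; elim/fracW: x => a b b0; elim/fracW: y => c d d0.
have dE : toF a / toF b * (toF c / toF d) = toF (a * c) / toF (b * d).
  by rewrite !toFM mulf_div.
by rewrite dE !residue_emb_frac ?mulf_neq0 // !fbarM.2 mulf_div.
Qed.

HB.instance Definition _ := GRing.isZmodMorphism.Build F K residue_emb residue_embB.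
HB.instance Definition _ := GRing.isMonoidMorphism.Build F K residue_emb residue_embM.

Lemma residue_embE b : residue_emb (to_residue_field kernel_ideal b) = f b.
Proof.
have -> : to_residue_field kernel_ideal b = toF (to_residue_dom kernel_ideal b) / toF 1.
  by rewrite [toF 1]rmorph1 divr1.
by rewrite residue_emb_frac ?oner_neq0 // fbar_pi fbarM.1 divr1.
Qed.

Lemma residue_emb_inj : injective residue_emb.
Proof. exact: fmorph_inj. Qed.

End KernelTheory.

Section Pullback.
Variables (B : comNzRingType) (K : realFieldType) (f : {rmorphism B -> K}).

Let ple : rel (residue_field (kernel_ideal f)) :=
  fun x y => residue_emb x <= residue_emb y.

Let ple_anti : antisymmetric ple.
Proof. by move=> x y /le_anti /residue_emb_inj. Qed.

Let ple_trans : transitive ple.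
Proof. by move=> y x z; apply: le_trans. Qed.

Let ple_total : total ple.
Proof. by move=> x y; apply: le_total. Qed.

Let ple_add x y z : ple x y -> ple (x + z) (y + z).
Proof. by rewrite /ple !rmorphD lerD2r. Qed.

Let ple_mul x y : ple 0 x -> ple 0 y -> ple 0 (x * y).
Proof. by rewrite /ple rmorphM rmorph0; apply: mulr_ge0. Qed.

Definition sper_pullback : sper B :=
  Sper ple_anti ple_trans ple_total ple_add ple_mul.

Definition pullback_emb : sper_field sper_pullback -> K := @residue_emb B K f.

Lemma pullback_embB : zmod_morphism pullback_emb. Proof. exact: rmorphB. Qed.
Lemma pullback_embM : monoid_morphism pullback_emb.
Proof. by split; [exact: rmorph1 | exact: rmorphM]. Qed.

HB.instance Definition _ :=
  GRing.isZmodMorphism.Build (sper_field sper_pullback) K pullback_emb pullback_embB.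
HB.instance Definition _ :=
  GRing.isMonoidMorphism.Build (sper_field sper_pullback) K pullback_emb pullback_embM.

Lemma pullback_embE b : pullback_emb (sper_eval sper_pullback b) = f b.
Proof. exact: residue_embE. Qed.

Lemma pullback_emb_le x y : (pullback_emb x <= pullback_emb y) = (x <= y).
Proof. by []. Qed.

End Pullback.

Section ChangeOfCoordinates.
Variables (R : rcfType) (n : nat) (T : {set 'I_n}).
Local Notation A := {mpoly R[n]}.

(** The coordinates y_j, in a field where the x_j are given. *)
Definition ycoord (F : fieldType) (x : 'I_n -> F) (j : 'I_n) : F :=
  if j \in T then (x j)^-1 else x j.

(** B_T = R[y_1, ..., y_n] is again a polynomial ring in n variables, so it is
    represented by [{mpoly R[n]}], where ['X_j] now stands for y_j; its
    inclusion in the fraction field of A is [BT_frac]. *)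
Definition BT_frac : A -> {fraction A} :=
  mmap (@FracField.tofrac A \o @mpolyC n R)
    (ycoord (fun j => FracField.tofrac ('X_j : A))).

Let BT_fracB : zmod_morphism BT_frac. Proof. exact: rmorphB. Qed.
Let BT_fracM : monoid_morphism BT_frac.
Proof. by split; [exact: rmorph1 | exact: rmorphM]. Qed.

HB.instance Definition _ :=
  GRing.isZmodMorphism.Build A {fraction A} BT_frac BT_fracB.
HB.instance Definition _ :=
  GRing.isMonoidMorphism.Build A {fraction A} BT_frac BT_fracM.

Variable delta : sper A.

Definition BT_eval : A -> sper_field delta :=
  mmap (sper_eval delta \o @mpolyC n R) (ycoord (fun j => sper_eval delta 'X_j)).

Let BT_evalB : zmod_morphism BT_eval. Proof. exact: rmorphB. Qed.
Let BT_evalM : monoid_morphism BT_eval.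
Proof. by split; [exact: rmorph1 | exact: rmorphM]. Qed.

HB.instance Definition _ :=
  GRing.isZmodMorphism.Build A (sper_field delta) BT_eval BT_evalB.
HB.instance Definition _ :=
  GRing.isMonoidMorphism.Build A (sper_field delta) BT_eval BT_evalM.

(** delta^* = psi(delta). This is meaningful when x_j does not lie in the
    support of delta for j in T; then [BT_eval] is the composite
    B_T -> (B_T)_(prod y_j) = A_(prod x_j) -> A(delta), and [supp_psiE] below
    gives the support in terms of p_delta A_(prod x_j). *)
Definition psi : sper A := sper_pullback BT_eval.

(** The inverse of the canonical isomorphism A(delta) -> B_T(delta^* ). *)
Definition phi_inv : sper_field psi -> sper_field delta :=
  @pullback_emb _ _ BT_eval.

Let phi_invB : zmod_morphism phi_inv.
Proof. exact: (@pullback_embB _ _ BT_eval). Qed.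
Let phi_invM : monoid_morphism phi_inv.
Proof. exact: (@pullback_embM _ _ BT_eval). Qed.

HB.instance Definition _ :=
  GRing.isZmodMorphism.Build (sper_field psi) (sper_field delta) phi_inv phi_invB.
HB.instance Definition _ :=
  GRing.isMonoidMorphism.Build (sper_field psi) (sper_field delta) phi_inv phi_invM.

Lemma phi_invE (g : A) : phi_inv (sper_eval psi g) = BT_eval g.
Proof. exact: pullback_embE. Qed.

Lemma phi_inv_le (u v : sper_field psi) : (phi_inv u <= phi_inv v) = (u <= v).
Proof. exact: (@pullback_emb_le _ _ BT_eval). Qed.

End ChangeOfCoordinates.

Lemma mpoly_ring_ind (R : comNzRingType) (n : nat) (P : {mpoly R[n]} -> Prop) :
  (forall c, P c%:MP) -> (forall i, P 'X_i) ->
  (forall p q, P p -> P q -> P (p + q)) ->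
  (forall p q, P p -> P q -> P (p * q)) -> forall p, P p.
Proof.
move=> PC PX PD PM p; rewrite (mpolyE p).
elim/big_ind: _ => [||m _]; first by rewrite -(mpolyC0 n).
  exact: PD.
rewrite -mul_mpolyC; apply: (PM) => //; rewrite mpolyXE_id.
elim/big_ind: _ => [||i _]; first by rewrite -(mpolyC1 n).
  exact: (PM).
elim: (m i) => [|k Pk]; first by rewrite expr0 -(mpolyC1 n).
by rewrite exprS; apply: PM.
Qed.

Section ChangeOfCoordinatesTheory.
Variables (R : rcfType) (n : nat) (T : {set 'I_n}).
Local Notation A := {mpoly R[n]}.
Variable delta : sper A.
Local Notation psi := (psi T delta).
Local Notation phi_inv := (@phi_inv R n T delta).
Local Notation BT_eval := (@BT_eval R n T delta).
Local Notation BT_frac := (@BT_frac R n T).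
Local Notation ycoord := (ycoord T).

Lemma sper_field_bij (F : fieldType) (f : {rmorphism F -> sper_field delta})
    (c : R -> F) (y : 'I_n -> F) :
  (forall a, f (c a) = sper_eval delta a%:MP) ->
  (forall j, f (y j) = ycoord (fun j => sper_eval delta 'X_j) j) ->
  bijective f.
Proof.
move=> cE yE.
have sdom (a : A) : exists u, f u = sper_eval delta a.
  elim/mpoly_ring_ind: a => [a|i|p q [u up] [v vq]|p q [u up] [v vq]].
  - by exists (c a).
  - move: (yE i); rewrite /ycoord; case: ifP => _ yiE; last by exists (y i).
    by exists (y i)^-1; rewrite fmorphV yiE invrK.
  - by exists (u + v); rewrite [LHS]rmorphD [RHS]rmorphD up vq.
  - by exists (u * v); rewrite [LHS]rmorphM [RHS]rmorphM up vq.
have surj (x : sper_field delta) : exists u, f u == x.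
  have xE := fraction_reprE (x : {fraction (residue_dom (supp delta))}).
  have d0 := denom_ratioP (repr (x : {fraction (residue_dom (supp delta))})).
  move: xE d0; set a := (_).1; set b := (_).2 => xE b0.
  have [u uE] := sdom (repr (a : {ideal_quot (supp delta)})).
  have [v vE] := sdom (repr (b : {ideal_quot (supp delta)})).
  have {}uE : f u = sper_dom_field (a : sper_dom delta).
    by rewrite uE -[a in RHS](reprK (a : {ideal_quot (supp delta)})).
  have {}vE : f v = sper_dom_field (b : sper_dom delta).
    by rewrite vE -[b in RHS](reprK (b : {ideal_quot (supp delta)})).
  have vb0 : sper_dom_field (b : sper_dom delta) != 0 by rewrite tofrac_eq0.
  exists (u / v); apply/eqP; rewrite fmorph_div uE vE.
  by apply: (mulIf vb0); rewrite divfK // [RHS]xE.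
exists (fun x => xchoose (surj x)) => x.
  by apply: (fmorph_inj f); apply/eqP/(xchooseP (surj _)).
exact/eqP/(xchooseP (surj _)).
Qed.

Lemma phi_inv_bij : bijective phi_inv.
Proof.
apply: (@sper_field_bij _ phi_inv (fun a => sper_eval psi a%:MP)
                                  (fun j => sper_eval psi 'X_j)) => [a|j].
  by apply: (etrans (phi_invE T delta _)); rewrite /BT_eval mmapC.
by apply: (etrans (phi_invE T delta _)); rewrite /BT_eval mmapX mmap1U.
Qed.

Lemma ycoord_clear_denom (g : A) : exists k a,
  forall (F : fieldType) (e : {rmorphism A -> F}),
    {in T, forall j, e 'X_j != 0} ->
    mmap (e \o @mpolyC n R) (ycoord (fun j => e 'X_j)) g
      * e (\prod_(j in T) 'X_j) ^+ k = e a.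
Proof.
set P := \prod_(j in T) _.
elim/mpoly_ring_ind: g => [c|j|p q [k [a aE]] [l [b bE]]|p q [k [a aE]] [l [b bE]]].
- by exists 0%N, c%:MP => F e _; rewrite mmapC expr0 mulr1.
- have [jT|jT] := boolP (j \in T); last first.
    exists 0%N, 'X_j => F e _.
    by rewrite mmapX mmap1U /ycoord (negbTE jT) expr0 mulr1.
  exists 1%N, (\prod_(i in T | i != j) 'X_i) => F e eT.
  rewrite mmapX mmap1U /ycoord jT expr1 /P (bigD1 j jT) /= rmorphM.
  by rewrite mulKf // eT.
- exists (k + l)%N, (a * P ^+ l + b * P ^+ k) => F e eT.
  rewrite [mmap _ _ _]rmorphD mulrDl exprD rmorphD !rmorphM !rmorphXn.
  by rewrite -(aE F e eT) -(bE F e eT) mulrA (mulrC (e P ^+ k)) mulrA.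
- exists (k + l)%N, (a * b) => F e eT.
  rewrite [mmap _ _ _]rmorphM exprD rmorphM -(aE F e eT) -(bE F e eT).
  by rewrite mulrACA.
Qed.

Lemma supp_psiE : {in T, forall j, 'X_j \notin supp delta} ->
  forall g : A, g \in supp psi <->
    exists k a, a \in supp delta /\
      BT_frac g * FracField.tofrac (\prod_(j in T) 'X_j) ^+ k = FracField.tofrac a.
Proof.
set P := \prod_(j in T) _ => hT g.
have eT : {in T, forall j, sper_eval delta 'X_j != 0}.
  by move=> j jT; rewrite sper_eval_eq0 hT.
have fT : {in T, forall j, FracField.tofrac ('X_j : A) != 0}.
  move=> j _; rewrite tofrac_eq0; apply/eqP => /(congr1 (mcoeff U_(j)%MM)).
  by rewrite mcoeffX eqxx mcoeff0 => /eqP; rewrite oner_eq0.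
have eP : sper_eval delta P != 0.
  by rewrite /P rmorph_prod; apply/prodf_neq0 => j jT; apply: eT.
have [l [b lbE]] := ycoord_clear_denom g.
have bE : BT_eval g * sper_eval delta P ^+ l = sper_eval delta b by exact: lbE eT.
have bF : BT_frac g * FracField.tofrac P ^+ l = FracField.tofrac b by exact: lbE fT.
have -> : (g \in supp psi) = (BT_eval g == 0) by exact: kernelE.
split=> [/eqP g0|[k [a [aS aE]]]].
  exists l, b; split=> //.
  by rewrite -sper_eval_eq0 -bE g0 mul0r.
have abE : a * P ^+ l = b * P ^+ k.
  apply/eqP; rewrite -tofrac_eq !tofracM !tofracXn -aE -bF.
  by rewrite mulrAC.
have : sper_eval delta (a * P ^+ l) = sper_eval delta (b * P ^+ k) by rewrite abE.
have a0 : sper_eval delta a = 0 by apply/eqP; rewrite sper_eval_eq0.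
have -> : sper_eval delta (a * P ^+ l) = 0.
  by rewrite [LHS]rmorphM /= a0 mul0r.
have -> : sper_eval delta (b * P ^+ k) = sper_eval delta b * sper_eval delta P ^+ k.
  by rewrite [LHS]rmorphM /= [X in _ * X]rmorphXn.
rewrite -bE => /esym/eqP.
by rewrite !mulf_eq0 !expf_eq0 (negbTE eP) !andbF !orbF.
Qed.

End ChangeOfCoordinatesTheory.

(** The sets I_delta, F_delta, G_delta; ['I_n] is numbered from 0, so that the
    indices 1, ..., p are the [j : 'I_n] with [j < p]. *)
Section Partition.
Variables (R : rcfType) (n p : nat) (delta : sper {mpoly R[n]}).
Local Notation x := (fun j : 'I_n => sper_eval delta 'X_j).
Local Notation cst := (fun c : R => sper_eval delta c%:MP).

Definition Iset : {set 'I_n} :=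
  [set j : 'I_n | (j < p)%N && `[< forall eps, 0 < eps -> `|x j| < cst eps >]].

Definition Fset : {set 'I_n} :=
  [set j : 'I_n | (j < p)%N &&
    `[< exists c1 c2, [/\ 0 < c1, 0 < c2, cst c1 < `|x j| & `|x j| < cst c2] >]].

Definition Gset : {set 'I_n} :=
  [set j : 'I_n | (j < p)%N && `[< forall N, cst N < `|x j| >]].

End Partition.

Definition is_prime_ideal_in (F : fieldType) (V P : {pred F}) : Prop :=
  [/\ {subset P <= V}, zmod_closed P,
      {in V & P, forall a x, a * x \in P}, 1 \notin P &
      {in V &, forall a b, a * b \in P -> (a \in P) || (b \in P)}].

(** [W] is the localization of the subring [V] of [F] at a prime ideal. *)
Definition is_localization_at_prime (F : fieldType) (V W : {pred F}) : Prop :=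
  exists2 P : {pred F}, is_prime_ideal_in V P &
    forall x, x \in W <->
      exists a s, [/\ a \in V, s \in V, s \notin P & x = a / s].

Definition is_isolated_subgroup (G : porderZmodType) (H : {pred G}) : Prop :=
  zmod_closed H /\ forall a b, 0 <= a -> a <= b -> b \in H -> a \in H.

(** Linear independence over the rationals of elements g_j of a torsion-free
    group G, viewed in its divisible hull: a relation with coefficients
    c_j = m_j / d holds there iff sum_j m_j g_j = 0 in G. *)
Definition rationally_independent (J : finType) (G : zmodType) (g : J -> G) : Prop :=
  forall (c : J -> rat) (d : int) (m : J -> int),
    d != 0 -> (forall j, c j = (m j)%:~R / d%:~R) ->
    \sum_j g j *~ m j = 0 -> forall j, c j = 0.

Definition in_generated (J : Type) (G : zmodType) (b : J -> G) (x : G) : Prop :=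
  forall H : {pred G}, zmod_closed H -> (forall j, b j \in H) -> x \in H.

(** The relation between tuples of elements of ordered groups; only the values
    of [f] on the subgroup generated by the [b j] matter. *)
Definition tuple_equiv (J : Type) (G G' : porderZmodType)
    (b : J -> G) (b' : J -> G') : Prop :=
  exists f : G -> G',
    [/\ forall x y, in_generated b x -> in_generated b y -> f (x + y) = f x + f y,
        forall x y, in_generated b x -> in_generated b y -> (f x <= f y) = (x <= y),
        forall x, in_generated b x -> in_generated b' (f x),
        forall z, in_generated b' z -> exists2 x, in_generated b x & f x = z &
        forall j, f (b j) = b' j].

(* Main.v *)
From HB Require Import structures.
Require Import Defs.
From mathcomp Require Import all_boot all_order all_algebra.
From mathcomp Require Import boolp mpoly.

(** Write [x_j] and [y_j] for the coordinates viewed in the ordered field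
    [A(delta)], identified with [B_T(delta^* )] by [phi_inv].

    For a polynomial ring, the valuation ring of a point is the convex hull of
    the values of all polynomials.  Inverting the coordinates in [T] makes all
    coordinates bounded by constants of [R]: those in [G] become infinitesimal,
    those in [F] stay between two positive constants, and a coordinate with
    positive value is smaller than 1 in absolute value.  Hence every polynomial
    in [y] is bounded by a constant ([mmap_bounded]), so that [delta^*] is finite
    and its valuation ring is exactly the convex hull of [R] in [A(delta)]
    ([psi_valringP]).  The signs of the values of the [y_j] with [j] in
    [I], [F] or [G] are then read off from the comparison of [y_j] with the
    constants.

    To compare the values over [I] with those over [G], take the coordinate
    [x_q], with [q] in [G], of largest absolute value. Any polynomial in [x] is
    bounded by a power of [x_q] ([mmap_le_infinite]). For [j] in [I], [x_j] is a
    unit of the valuation ring of [delta], so [1 / x_j] is bounded by a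
    polynomial in [x], hence by [|x_q| ^ k]. As [y_q = 1 / x_q] and [y_j = x_j],
    this makes [y_q ^ (k + 1) / y_j] infinitesimal ([valuation_lt_muln]).
    Without such a [q] all coordinates are bounded by constants, so the inverse
    of an infinitesimal one is not bounded by a polynomial, and [I] is empty.

    The hull of [R] lies in the hull of [R[x]], so the valuation of [delta] is a
    coarsening of that of [delta^*].  The rest consists of general facts on
    coarsenings, once it is noted that inverting a coordinate in [T] does not
    change its value at [delta], which is 0.  The larger ring is the localization
    of the smaller at its own maximal ideal; the induced map of value groups is
    monotone, so its kernel is convex and anything in the kernel lies below any
    element of positive image; and on a subgroup whose generators have
    independent images it is injective, hence an isomorphism of ordered groups. *)

Set Implicit Arguments.
Unset Strict Implicit.
Unset Printing Implicit Defensive.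

Import Order.TTheory GRing.Theory Num.Theory.
Local Open Scope ring_scope.

(** * Comparing values in a valuation ring *)

Lemma valuationE (F : fieldType) (V : valring F) (u : F) (u0 : u != 0) :
  valuation V u = Some (val_class V (exist _ u u0)).
Proof. by rewrite /valuation insubT. Qed.

Lemma valuation0 (F : fieldType) (V : valring F) : valuation V 0 = None.
Proof. by rewrite /valuation insubF // eqxx. Qed.

Lemma valuation1 (F : fieldType) (V : valring F) : valuation V 1 = Some 0.
Proof. exact: valuationE. Qed.

(** By totality, a strict inequality of values is a non-membership; this is the
    form in which every inequality of values is checked here. *)
Lemma valuation_lt (F : fieldType) (V : valring F) (u v : F) : u != 0 ->
  voo_lt (valuation V u) (valuation V v) = (v == 0) || (u / v \notin V).
Proof.
move=> u0; rewrite (valuationE _ u0); have [->|v0] := eqVneq v 0.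
  by rewrite valuation0.
by rewrite (valuationE _ v0) /= ltNge val_class_le.
Qed.

Lemma valuation_gt0 (F : fieldType) (V : valring F) (u : F) :
  voo_lt (Some 0) (valuation V u) = (u == 0) || (u^-1 \notin V).
Proof. by rewrite -(valuation1 V) valuation_lt ?oner_neq0 // mul1r. Qed.

Lemma valuation_eq0 (F : fieldType) (V : valring F) (u : F) :
  valuation V u = Some 0 <-> [/\ u != 0, u \in V & u^-1 \in V].
Proof.
have [->|u0] := eqVneq u 0; first by rewrite valuation0; split=> [|[]].
rewrite (valuationE _ u0); split=> [[uE]|[_ uV uVV]].
  have h a b : val_class V a = val_class V b -> sval b / sval a \in V.
    by move=> ab; rewrite -val_class_le ab.
  by split=> //; [have /= := h _ _ (esym uE) | have /= := h _ _ uE];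
    rewrite ?divr1 ?mul1r.
congr Some; apply/le_anti.
have -> : 0 = val_class V (exist _ 1 (oner_neq0 F)) by [].
rewrite !val_class_le /=.
by rewrite mul1r divr1 uV uVV.
Qed.

Lemma valuationX (F : fieldType) (V : valring F) (u : F) (k : nat) : u != 0 ->
  voo_muln k (valuation V u) = valuation V (u ^+ k).
Proof.
move=> u0; rewrite (valuationE _ u0) /=.
elim: k => [|k IH]; first by rewrite mulr0n expr0 valuation1.
have uk0 : u ^+ k != 0 by rewrite expf_neq0.
have ukS0 : u ^+ k.+1 != 0 by rewrite expf_neq0.
move: IH; rewrite (valuationE _ uk0) (valuationE _ ukS0) => -[IH].
rewrite mulrS IH val_classD; congr (Some (val_class _ _)).
by apply: val_inj; rewrite /= exprS.
Qed.

(** * Tuples in ordered groups *)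

Lemma in_generatedP (J : finType) (G : zmodType) (b : J -> G) (x : G) :
  in_generated b x <-> exists m : J -> int, x = \sum_j b j *~ m j.
Proof.
split=> [|[m ->] H [H0 HB] bH].
  move/(_ (fun z => `[< exists m : J -> int, z = \sum_j b j *~ m j >])) => h.
  apply/asboolP; apply: h => [|j].
    split=> [|u v /asboolP[m ->] /asboolP[k ->]]; apply/asboolP.
      by exists (fun=> 0); rewrite big1 // => j _; rewrite mulr0z.
    exists (fun j => m j - k j); rewrite -sumrB.
    by apply: eq_bigr => j _; rewrite mulrzBr.
  apply/asboolP; exists (fun i => (i == j)%:Z).
  rewrite (bigD1 j) //= eqxx mulr1z big1 ?addr0 // => i /negbTE->.
  by rewrite mulr0z.
have HN z : z \in H -> - z \in H by move=> zH; rewrite -sub0r HB.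
have HD z w : z \in H -> w \in H -> z + w \in H.
  by move=> zH wH; rewrite -(opprK w) HB ?HN.
have Hn z k : z \in H -> z *+ k \in H.
  by move=> zH; elim: k => [|k IH]; rewrite ?mulr0n ?mulrS ?HD.
elim/big_ind: _ => // j _; case: (m j) => k; first by rewrite -pmulrn Hn.
by rewrite NegzE mulrNz -pmulrn HN ?Hn.
Qed.

(** Independence of the images makes [f] injective on the subgroup generated by
    [b], and an injective monotone map on a totally ordered set reflects the
    order. *)
Lemma tuple_equiv_of_independent (J : finType) (G G' : porderZmodType)
    (f : {additive G -> G'}) (b : J -> G) :
  total (<=%R : rel G) -> {homo f : x y / x <= y} ->
  rationally_independent (f \o b) -> tuple_equiv b (f \o b).
Proof.
move=> le_tot f_homo indep.
have fE m : f (\sum_j b j *~ m j) = \sum_j f (b j) *~ m j.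
  by rewrite raddf_sum; apply: eq_bigr => j _; rewrite raddfMz.
have f_inj x y : in_generated b x -> in_generated b y -> f x = f y -> x = y.
  move=> /in_generatedP[m ->] /in_generatedP[k ->].
  rewrite !fE => /eqP; rewrite -subr_eq0 -sumrB => /eqP mk.
  have mk0 : \sum_j (f \o b) j *~ (m j - k j) = 0.
    by rewrite -[RHS]mk; apply: eq_bigr => j _; rewrite mulrzBr.
  apply: eq_bigr => j _; congr (_ *~ _); apply/eqP; rewrite -subr_eq0.
  (* Integer coefficients are rational ones with denominator 1. *)
  have := indep (fun j => (m j - k j)%:~R) 1 (fun j => m j - k j)
    (oner_neq0 _) (fun j => esym (divr1 _)) mk0 j.
  by move/eqP; rewrite intr_eq0.
exists f; split=> //.
- by move=> x y _ _; rewrite raddfD.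
- move=> x y xb yb; apply/idP/idP => [fxy|/f_homo//].
  have /orP[//|yx] := le_tot x y.
  by rewrite (f_inj x y) //; apply: le_anti; rewrite fxy f_homo.
- by move=> x /in_generatedP[m ->]; apply/in_generatedP; exists m; rewrite fE.
- move=> z /in_generatedP[m ->]; exists (\sum_j b j *~ m j); rewrite ?fE //.
  by apply/in_generatedP; exists m.
Qed.

(** * Coarsening a valuation *)

Section Coarsening.
Variables (F F' : fieldType) (V : valring F) (W : valring F').
Variable f : {rmorphism F -> F'}.
Hypothesis fVW : {in V, forall u, f u \in W}.

(** The prime ideal is the maximal ideal of the larger ring.  It lies in [V],
    because an element outside [V] has its inverse in [V], hence is a unit of the
    larger ring.  If [x] is in the larger ring but not in [V], then
    [x = 1 / x^-1] with [x^-1] in [V] a unit of the larger ring. *)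
Lemma localization_of_coarsening :
  is_localization_at_prime V [pred u | f u \in W].
Proof.
have [V1 VB VM] := valring_closed V; have [W1 WB WM] := valring_closed W.
pose P : {pred F} := [pred u | (u == 0) || ((f u)^-1 \notin W)].
have PE u : (u \in P) = (u == 0) || ((f u)^-1 \notin W) by [].
have V0 : 0 \in V by rewrite -(subrr 1) VB.
have PV : {subset P <= V}.
  move=> u; rewrite PE => /orP[/eqP-> //|uW].
  have /orP[//|/fVW] := valring_total V u.
  by rewrite fmorphV (negbTE uW).
have PM : {in V & P, forall a x, a * x \in P}.
  move=> a x aV; rewrite !PE mulf_eq0.
  have [//|a0] := eqVneq a 0; have [//|x0] := eqVneq x 0.
  rewrite /=; apply: contra => /(WM _ _ (fVW aV)).
  by rewrite rmorphM invfM mulVKf // fmorph_eq0.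
exists P; first split=> //.
- split=> [|x y]; first by rewrite PE eqxx.
  (* If x / y is in V then x - y is a multiple of y, and symmetrically. *)
  have step u v : u \in P -> v \in P -> u / v \in V -> u - v \in P.
    move=> uP vP uv; have [v0|v0] := eqVneq v 0; first by rewrite v0 subr0.
    have -> : u - v = (u / v - 1) * v by rewrite mulrBl divfK ?mul1r.
    by apply: PM => //; apply: VB.
  move=> xP yP; have /orP[|] := valring_total V (x / y); first exact: step.
  rewrite invfM invrK mulrC => /(step _ _ yP xP) yx.
  have NV1 : -1 \in V by rewrite -sub0r VB.
  by rewrite -opprB -mulN1r; apply: PM.
- by rewrite PE oner_eq0 rmorph1 invr1 W1.
- move=> a b _ _; rewrite !PE mulf_eq0.
  have [//|a0] := eqVneq a 0; have [|b0] := eqVneq b 0; first by rewrite !orbT.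
  rewrite /= rmorphM invfM -negb_and; apply: contra => /andP[]; exact: WM.
- move=> x; rewrite inE; split=> [xW|[a [s [aV sV]]]].
    have /orP[xV|xV] := valring_total V x.
      by exists x, 1; rewrite divr1 PE oner_eq0 rmorph1 invr1 W1.
    have [x0|x0] := eqVneq x 0.
      by exists 0, 1; rewrite divr1 PE oner_eq0 rmorph1 invr1 W1.
    exists 1, x^-1; split=> //; last by rewrite invrK mul1r.
    by rewrite PE invr_eq0 (negbTE x0) fmorphV invrK xW.
  rewrite PE negb_or negbK => /andP[_ sW] ->.
  by rewrite fmorph_div WM // fVW.
Qed.

Let image_nonzero (u : nonzero_elt F) : nonzero_elt F' :=
  exist _ (f (sval u)) (etrans (congr1 negb (fmorph_eq0 f _)) (svalP u)).

(** The map induced on classes, computed on chosen representatives; it does not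
    depend on them because [f] sends units of [V] to units of [W]. *)
Let coarsen (a : value_group V) : value_group W :=
  val_class W (image_nonzero (repr a)).

Let coarsen_classE u : coarsen (val_class V u) = val_class W (image_nonzero u).
Proof.
have h a b : val_class V a <= val_class V b ->
    val_class W (image_nonzero a) <= val_class W (image_nonzero b).
  by rewrite !val_class_le /= -fmorph_div => /fVW.
have rE : val_class V (repr (val_class V u)) = val_class V u.
  by rewrite /val_class reprK.
by apply/le_anti; rewrite !h // rE.
Qed.

Lemma coarsening_hom :
  exists g : {additive value_group V -> value_group W},
    (forall u, omap g (valuation V u) = valuation W (f u)) /\
    {homo g : a b / a <= b}.
Proof.
have cD a b : coarsen (a + b) = coarsen a + coarsen b.
  elim/val_classW: a => u; elim/val_classW: b => v.
  rewrite val_classD !coarsen_classE val_classD; congr val_class.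
  by apply: val_inj; rewrite /= rmorphM.
have cB : zmod_morphism coarsen.
  by move=> a b; apply: (addIr (coarsen b)); rewrite -cD !subrK.
pose c := GRing.isZmodMorphism.Build _ _ coarsen cB.
pose g : {additive value_group V -> value_group W} := HB.pack coarsen c.
exists g; split=> [u|a b].
  have [->|u0] := eqVneq u 0; first by rewrite rmorph0 !valuation0.
  have fu0 : f u != 0 by rewrite fmorph_eq0.
  rewrite (valuationE _ u0) (valuationE _ fu0) /=; congr Some.
  by rewrite -[LHS]/(coarsen _) coarsen_classE; congr val_class; apply: val_inj.
rewrite -[g a]/(coarsen a) -[g b]/(coarsen b).
elim/val_classW: a => u; elim/val_classW: b => v.
by rewrite !coarsen_classE !val_class_le /= -fmorph_div => /fVW.
Qed.

Variable g : {additive value_group V -> value_group W}.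
Hypothesis gE : forall u, omap g (valuation V u) = valuation W (f u).
Hypothesis g_homo : {homo g : a b / a <= b}.

Lemma coarsening_surj :
  (forall w, exists u, f u = w) -> forall b, exists a, g a = b.
Proof.
move=> f_surj; elim/val_classW=> w; have [u uw] := f_surj (sval w).
have u0 : u != 0 by rewrite -(fmorph_eq0 f) uw (svalP w).
exists (val_class V (exist _ u u0)); have := gE u.
rewrite uw (valuationE _ u0) (valuationE _ (svalP w)) => -[->].
by congr val_class; apply: val_inj.
Qed.

Lemma coarsening_ker_isolated : is_isolated_subgroup [pred a | g a == 0].
Proof.
split=> [|a b a0 ab]; first split=> [|a b].
- by rewrite inE raddf0.
- by rewrite !inE raddfB => /eqP-> /eqP->; rewrite subr0.
- rewrite !inE => /eqP b0; rewrite eq_le -{1}b0 (g_homo ab) /=.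
  by rewrite -(raddf0 g) g_homo.
Qed.

(** An element [b <= N * a] would have an image at most [N * g a = 0]. *)
Lemma coarsening_ker_lt (N : nat) (a b : option (value_group V)) :
  omap g a = Some 0 -> voo_lt (Some 0) (omap g b) ->
  voo_lt (voo_muln N a) b.
Proof.
case: a => //= a [a0]; case: b => //= b; rewrite !ltNge.
by apply: contra => /g_homo; rewrite raddfMn /= a0 mul0rn.
Qed.

Lemma coarsening_tuple_equiv (J : finType) (a : J -> option (value_group V))
    (b : J -> value_group W) :
  (forall j, omap g (a j) = Some (b j)) -> rationally_independent b ->
  exists b' : J -> value_group V, (forall j, a j = Some (b' j)) /\ tuple_equiv b' b.
Proof.
move=> ab b_indep.
have /choice[b' b'E] j : exists h, a j = Some h /\ g h = b j.
  by have := ab j; case: (a j) => //= h [hE]; exists h.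
exists b'; split=> [j|]; first exact: (b'E j).1.
have bE : b = g \o b' by apply/funext => j; rewrite /= (b'E j).2.
rewrite bE in b_indep *; apply: tuple_equiv_of_independent => //.
exact: le_total.
Qed.

End Coarsening.

(** * Bounds by constants in an ordered extension of a real closed field *)

Lemma order_morph_norm (K K' : realFieldType) (f : {rmorphism K -> K'}) :
  {mono f : u v / u <= v} -> {morph f : u / `|u|}.
Proof.
move=> f_le u; have [u0|u0] := ger0P u.
  by rewrite ger0_norm // -(rmorph0 f) f_le.
by rewrite rmorphN ltr0_norm // -(rmorph0 f) ltNge f_le -ltNge.
Qed.

Section Constants.
Variables (R : rcfType) (K : realFieldType) (c : {rmorphism R -> K}).

(** Order preservation is automatic: a nonnegative element of a real closed
    field is a square. *)
Lemma rcf_morph_le : {homo c : a b / a <= b}.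
Proof.
move=> a b; rewrite -subr_ge0 => /sqr_sqrtr ab.
by rewrite -subr_ge0 -rmorphB -ab rmorphXn sqr_ge0.
Qed.

Lemma rcf_morph_lt : {homo c : a b / a < b}.
Proof. by apply: inj_homo_lt; [exact: fmorph_inj | exact: rcf_morph_le]. Qed.

(** The bound [M] is left free so as to cover both uses: a constant [M] shows
    that the polynomial is bounded by a constant, an infinite [M] that it is
    bounded by a power of [M]. *)
Lemma mmap_bound (n : nat) (h : 'I_n -> K) (M : K) (b : {mpoly R[n]}) :
  1 <= M -> (forall j, `|h j| <= M) ->
  exists N k, 0 <= N /\ `|mmap c h b| <= c N * M ^+ k.
Proof.
move=> M1 hM.
elim/mpoly_ring_ind: b => [a|j|u v [N [k [N0 uN]]] [L [l [L0 vL]]]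
                               |u v [N [k [N0 uN]]] [L [l [L0 vL]]]].
- exists `|a|, 0%N; split=> //; rewrite mmapC expr0 mulr1.
  rewrite real_ler_norml ?num_real // -rmorphN.
  by rewrite !rcf_morph_le ?ler_norm // lerNl ler_normr lexx orbT.
- exists 1, 1%N; split; first exact: ler01.
  by rewrite mmapX mmap1U rmorph1 mul1r expr1.
- exists (N + L), (k + l)%N; split; first exact: addr_ge0.
  rewrite !rmorphD mulrDl /= (le_trans (ler_normD _ _)) // lerD //.
    apply: (le_trans uN); rewrite ler_wpM2l ?(ler_weXn2l M1) ?leq_addr //.
    by rewrite -(rmorph0 c) rcf_morph_le.
  apply: (le_trans vL); rewrite ler_wpM2l ?(ler_weXn2l M1) ?leq_addl //.
  by rewrite -(rmorph0 c) rcf_morph_le.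
- exists (N * L), (k + l)%N; split; first exact: mulr_ge0.
  by rewrite !rmorphM normrM exprD mulrACA ler_pM.
Qed.

Lemma infinitesimal_inv_unbounded (u : K) (N : R) :
  (forall eps, 0 < eps -> `|u| < c eps) -> u != 0 -> c N < `|u^-1|.
Proof.
move=> u_small u0; have [N0|N0] := lerP N 0.
  apply: (@le_lt_trans _ _ 0); first by rewrite -(rmorph0 c) rcf_morph_le.
  by rewrite normr_gt0 invr_eq0.
have := u_small N^-1; rewrite invr_gt0 => /(_ N0).
have cN0 : 0 < c N by rewrite -(rmorph0 c) rcf_morph_lt.
by rewrite fmorphV normfV invf_pgt // posrE normr_gt0.
Qed.

Lemma mmap_bounded (n : nat) (h : 'I_n -> K) (b : {mpoly R[n]}) :
  (forall j, exists N, `|h j| <= c N) -> exists N, `|mmap c h b| <= c N.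
Proof.
move=> /choice[f fP]; pose N := \sum_j `|f j| + 1.
have N1 : 1 <= N by rewrite lerDr sumr_ge0.
have [|j|L [k [_ bL]]] := @mmap_bound n h (c N) b.
- by rewrite -(rmorph1 c) rcf_morph_le.
- apply: le_trans (fP j) _; apply: rcf_morph_le.
  rewrite (le_trans (ler_norm _)) // /N (bigD1 j) //= -addrA lerDl.
  by rewrite addr_ge0 ?sumr_ge0.
by exists (L * N ^+ k); rewrite rmorphM rmorphXn.
Qed.

(** The constant factor of [mmap_bound] is absorbed by one more power of the
    infinite element. *)
Lemma mmap_le_infinite (n : nat) (x : 'I_n -> K) (q : 'I_n) (a : {mpoly R[n]}) :
  (forall N, c N < `|x q|) -> (forall j, `|x j| <= `|x q|) ->
  exists k, `|mmap c x a| <= `|x q| ^+ k.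
Proof.
move=> q_inf q_max.
have q1 : 1 <= `|x q| by rewrite -(rmorph1 c) ltW.
have [N [k [_ aN]]] := mmap_bound a q1 q_max; exists k.+1.
apply: le_trans aN _; rewrite exprS ler_wpM2r ?exprn_ge0 //; exact: ltW.
Qed.

(** The valuation whose ring is the convex hull of the constants, read through a
    field morphism [f] into the ordered field. *)
Section Hull.
Variables (L : fieldType) (V : valring L) (f : {rmorphism L -> K}).
Hypothesis VP : forall u, u \in V <-> exists N, `|f u| <= c N.

Lemma valuation_unit (u : L) : f u != 0 -> (exists N, `|f u| <= c N) ->
  (exists N, `|(f u)^-1| <= c N) -> valuation V u = Some 0.
Proof.
move=> u0 ub uVb; apply/valuation_eq0.
by split; [rewrite -(fmorph_eq0 f) | apply/VP | apply/VP; rewrite fmorphV].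
Qed.

Lemma valuation_infinitesimal (u : L) :
  (forall eps, 0 < eps -> `|f u| < c eps) -> voo_lt (Some 0) (valuation V u).
Proof.
move=> u_small; rewrite valuation_gt0; have [//|u0] := eqVneq u 0.
apply/negP => /VP[N]; rewrite fmorphV leNgt infinitesimal_inv_unbounded //.
by rewrite fmorph_eq0.
Qed.

(** The quotient [u / v ^+ k.+1] is at least [|1 / v|] in absolute value, hence
    not bounded by a constant.  The exponent [k.+1] rather than [k] is what makes
    the inequality of values strict. *)
Lemma valuation_lt_muln (u v : L) (k : nat) :
  (forall N, c N < `|(f v)^-1|) -> u != 0 -> v != 0 ->
  `|(f u)^-1| <= `|(f v)^-1| ^+ k ->
  voo_lt (valuation V u) (voo_muln k.+1 (valuation V v)).
Proof.
move=> v_inf u0 v0 uv; rewrite valuationX // valuation_lt //.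
apply/orP; right; apply/negP => /VP[N].
rewrite fmorph_div rmorphXn leNgt => /negP; apply; apply: lt_le_trans (v_inf N) _.
rewrite normrM -exprVn normrX exprSr mulrA ler_peMl //.
rewrite -(mulfV (x := `|f u|)) ?normr_eq0 ?fmorph_eq0 // ler_wpM2l //.
by rewrite -normfV.
Qed.

End Hull.

End Constants.

Section Ycoord.
Variables (n : nat) (T : {set 'I_n}) (F : fieldType) (x : 'I_n -> F).

Lemma ycoord_in j : j \in T -> ycoord T x j = (x j)^-1.
Proof. by rewrite /ycoord => ->. Qed.

Lemma ycoord_notin j : j \notin T -> ycoord T x j = x j.
Proof. by rewrite /ycoord => /negbTE->. Qed.

Lemma ycoord_eq0 j : (ycoord T x j == 0) = (x j == 0).
Proof. by rewrite /ycoord; case: ifP => _ //; rewrite invr_eq0. Qed.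

Lemma fmorph_ycoord_eq0 (L : fieldType) (f : {rmorphism L -> F}) (u : L) j :
  f u = ycoord T x j -> (u == 0) = (x j == 0).
Proof. by rewrite -(fmorph_eq0 f) => ->; apply: ycoord_eq0. Qed.

(** Inverting an element of value 0 leaves its value unchanged. *)
Lemma valuation_ycoord (W : valring F) j :
  (j \in T -> valuation W (x j) = Some 0) ->
  valuation W (ycoord T x j) = valuation W (x j).
Proof.
rewrite /ycoord; case: ifP => // _ /(_ isT) xj; rewrite xj; apply/valuation_eq0.
by have /valuation_eq0[] := xj; rewrite invrK invr_eq0.
Qed.

End Ycoord.

(** * The point delta^* and its valuation ring *)

Lemma sper_valringP (B : comNzRingType) (alpha : sper B) (u : sper_field alpha) :
  u \in sper_valring alpha <-> exists b : B, `|u| <= sper_eval alpha b.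
Proof.
split=> [/asboolP[z uz]|[b ub]]; last first.
  by apply/asboolP; exists (to_residue_dom (supp alpha) b).
exists (repr (z : {ideal_quot (supp alpha)})); apply: le_trans uz _.
by rewrite -[z in sper_dom_field z](reprK (z : {ideal_quot (supp alpha)})).
Qed.

Section Psi.
Variables (R : rcfType) (n : nat) (T : {set 'I_n}) (delta : sper {mpoly R[n]}).
Local Notation A := {mpoly R[n]}.
Local Notation x := (fun j : 'I_n => sper_eval delta 'X_j).
Local Notation cst := (sper_eval delta \o @mpolyC n R).
Local Notation y := (ycoord T x).
Local Notation phi := (@phi_inv R n T delta).

Lemma sper_eval_mmap (a : A) : sper_eval delta a = mmap cst x a.
Proof.
elim/mpoly_ring_ind: a => [a|j|u v uE vE|u v uE vE].
- by rewrite mmapC.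
- by rewrite mmapX mmap1U.
- by rewrite !rmorphD /= -uE -vE.
- by rewrite !rmorphM /= -uE -vE.
Qed.

Lemma phi_inv_norm (u : sper_field (psi T delta)) : phi `|u| = `|phi u|.
Proof. exact: (order_morph_norm (f := phi) (@phi_inv_le R n T delta)). Qed.

Lemma phi_invX (j : 'I_n) : phi (sper_eval (psi T delta) 'X_j) = y j.
Proof. by apply: (etrans (phi_invE T delta _)); rewrite /BT_eval mmapX mmap1U. Qed.

Lemma phi_invC (c : R) : phi (sper_eval (psi T delta) c%:MP) = cst c.
Proof. by apply: (etrans (phi_invE T delta _)); rewrite /BT_eval mmapC. Qed.

Hypothesis y_bounded : forall j, exists N : R, `|y j| <= cst N.

Lemma BT_eval_bounded (b : A) : exists N, `|BT_eval T delta b| <= cst N.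
Proof. exact: (mmap_bounded (c := cst)). Qed.

Lemma sper_finite_psi : sper_finite (psi T delta).
Proof.
move=> z; have [N zN] :=
  BT_eval_bounded (repr (z : {ideal_quot (supp (psi T delta))})).
exists (N + 1).
have -> : sper_dom_field z =
    sper_eval (psi T delta) (repr (z : {ideal_quot (supp (psi T delta))})).
  by rewrite -[z in LHS](reprK (z : {ideal_quot (supp (psi T delta))})).
rewrite ltNge -phi_inv_le -ltNge phi_inv_norm phi_invE.
apply: le_lt_trans zN _; rewrite -mul_mpolyC mulr1 phi_invC.
by apply: rcf_morph_lt; rewrite ltrDl ltr01.
Qed.

(** As the coordinates of [delta^*] are bounded by constants, the polynomials in
    the definition of its valuation ring can be replaced by constants. *)
Lemma psi_valringP (u : sper_field (psi T delta)) :
  u \in sper_valring (psi T delta) <-> exists N : R, `|phi u| <= cst N.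
Proof.
split=> [/sper_valringP[b ub]|[N uN]].
  have [N bN] := BT_eval_bounded b; exists N.
  move: ub; rewrite -phi_inv_le phi_inv_norm phi_invE => ub.
  exact: le_trans ub (le_trans (ler_norm _) bN).
by apply/sper_valringP; exists N%:MP; rewrite -phi_inv_le phi_inv_norm phi_invC.
Qed.

Lemma psi_valring_sub :
  {in sper_valring (psi T delta), forall u, phi u \in sper_valring delta}.
Proof.
by move=> u /psi_valringP[N uN]; apply/sper_valringP; exists N%:MP.
Qed.

End Psi.

(** * Infinitesimal, finite and infinite coordinates *)

Section Coordinates.
Variables (R : rcfType) (n p : nat) (delta : sper {mpoly R[n]}).
Variable T : {set 'I_n}.
Local Notation x := (fun j : 'I_n => sper_eval delta 'X_j).
Local Notation cst := (sper_eval delta \o @mpolyC n R).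

Lemma IsetP (j : 'I_n) : j \in Iset p delta ->
  (j < p)%N /\ forall eps : R, 0 < eps -> `|x j| < cst eps.
Proof. by rewrite inE => /andP[jp /asboolP]. Qed.

Lemma FsetP (j : 'I_n) : j \in Fset p delta ->
  (j < p)%N /\ exists c1 c2 : R,
    [/\ 0 < c1, 0 < c2, cst c1 < `|x j| & `|x j| < cst c2].
Proof. by rewrite inE => /andP[jp /asboolP]. Qed.

Lemma GsetP (j : 'I_n) : j \in Gset p delta ->
  (j < p)%N /\ forall N : R, cst N < `|x j|.
Proof. by rewrite inE => /andP[jp /asboolP]. Qed.

Lemma Iset_notin_GF (j : 'I_n) :
  j \in Iset p delta -> j \notin Gset p delta :|: Fset p delta.
Proof.
move=> /IsetP[_ xI]; apply/negP; rewrite in_setU => /orP[/GsetP[_ xG]|/FsetP[_]].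
  by have := lt_trans (xG 1) (xI 1 ltr01); rewrite ltxx.
move=> [c1 [c2 [c10 _ xc1 _]]].
by have := lt_trans xc1 (xI c1 c10); rewrite ltxx.
Qed.

Lemma Fset_bounded (j : 'I_n) : j \in Fset p delta ->
  [/\ x j != 0, exists N, `|x j| <= cst N & exists N, `|(x j)^-1| <= cst N].
Proof.
move=> /FsetP[_ [c1 [c2 [c10 _ xc1 xc2]]]].
have cc1 : 0 < cst c1 by rewrite -(rmorph0 cst) rcf_morph_lt.
have x0 : 0 < `|x j| := lt_trans cc1 xc1.
split; first by rewrite -normr_gt0.
- by exists c2; apply: ltW.
- exists c1^-1; rewrite normfV [X in _ <= X](fmorphV cst).
  by rewrite lef_pV2 ?posrE // ltW.
Qed.

(** For [j >= p], [|x_j| > 1] would give [|1 / x_j| < 1], so [1 / x_j] would be in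
    the valuation ring, against the positivity of the value of [x_j]. *)
Lemma notin_Gset_bounded (j : 'I_n) :
  (forall j : 'I_n, (p <= j)%N -> voo_lt (Some 0) (nu delta 'X_j)) ->
  j \notin Gset p delta -> exists N, `|x j| <= cst N.
Proof.
move=> xpos; have [pj _|jp] := leqP p j.
  exists 1; rewrite (rmorph1 cst) leNgt; apply/negP => x1.
  have x0 : x j != 0 by rewrite -normr_gt0 (lt_trans ltr01 x1).
  have := xpos j pj; rewrite valuation_gt0 (negbTE x0) /= => /negP; apply.
  apply/sper_valringP; exists 1; rewrite rmorph1 normfV invf_le1 ?ltW //.
  exact: lt_trans ltr01 x1.
rewrite inE jp /= => /asboolPn/existsNP[N /negP]; rewrite -leNgt => xN.
by exists N.
Qed.

(** If no coordinate is infinite, all are bounded by constants, and so are all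
    polynomials in them.  The inverse of an infinitesimal unit [x_i] would be
    bounded by a polynomial, hence by a constant, which is absurd. *)
Lemma Gset_exists_dominating :
  (forall j : 'I_n, (j < p)%N -> nu delta 'X_j = Some 0) ->
  (forall j : 'I_n, (p <= j)%N -> voo_lt (Some 0) (nu delta 'X_j)) ->
  Iset p delta :|: Gset p delta != set0 ->
  exists2 q, q \in Gset p delta & forall j, `|x j| <= `|x q|.
Proof.
move=> xunit xpos IG.
have [G0|[q0 q0G]] := set_0Vmem (Gset p delta); last first.
  have [q qG qmax] := @Order.TotalTheory.arg_maxP _ _ _ q0
    (fun j => j \in Gset p delta) (fun j => `|x j|) q0G.
  exists q => // j; have [jG|jG] := boolP (j \in Gset p delta).
    exact: qmax.
  have [N xN] := notin_Gset_bounded xpos jG; apply: le_trans xN _.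
  by apply: ltW; apply: (GsetP qG).2.
move: IG; rewrite G0 setU0 => /set0Pn[i iI].
have [ip xi] := IsetP iI.
have /valuation_eq0[xi0 _ /sper_valringP[a xia]] := xunit i ip.
have [|N aN] := mmap_bounded (c := cst) (h := x) a.
  by move=> j; apply: notin_Gset_bounded => //; rewrite G0 in_set0.
have := infinitesimal_inv_unbounded (c := cst) N xi xi0.
rewrite ltNge (le_trans xia) // sper_eval_mmap.
exact: le_trans (ler_norm _) aN.
Qed.

(** Each [1 / x_j] is bounded by a polynomial since [x_j] is a unit; the sum of
    the exponents obtained serves all [j] at once. *)
Lemma Iset_inv_growth (q : 'I_n) :
  (forall j : 'I_n, (j < p)%N -> nu delta 'X_j = Some 0) ->
  q \in Gset p delta -> (forall j, `|x j| <= `|x q|) ->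
  exists k, forall j, j \in Iset p delta -> `|(x j)^-1| <= `|x q| ^+ k.
Proof.
move=> xunit qG qmax; have [_ qinf] := GsetP qG.
have /choice[k kP] (j : 'I_n) :
    exists k, j \in Iset p delta -> `|(x j)^-1| <= `|x q| ^+ k.
  have [jI|_] := boolP (j \in Iset p delta); last by exists 0%N.
  have /valuation_eq0[_ _ /sper_valringP[a xa]] := xunit j (IsetP jI).1.
  have [k ak] := mmap_le_infinite (c := cst) a qinf qmax.
  exists k => _; apply: le_trans xa _; rewrite sper_eval_mmap.
  exact: le_trans (ler_norm _) ak.
have q1 : 1 <= `|x q| by rewrite -(rmorph1 cst); apply: ltW (qinf 1).
exists (\sum_j k j)%N => j jI; apply: le_trans (kP j jI) _.
by apply: ler_weXn2l => //; rewrite (bigD1 j) //= leq_addr.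
Qed.

Hypothesis xpos :
  forall j : 'I_n, (p <= j)%N -> voo_lt (Some 0) (nu delta 'X_j).
Hypotheses (GT : Gset p delta \subset T) (TGF : T \subset Gset p delta :|: Fset p delta).

Lemma ycoord_bounded (j : 'I_n) : exists N, `|ycoord T x j| <= cst N.
Proof.
have [jT|jT] := boolP (j \in T); last first.
  rewrite ycoord_notin //; apply: notin_Gset_bounded => //.
  by apply: contra jT; apply: (subsetP GT).
rewrite ycoord_in //; have := subsetP TGF j jT.
rewrite in_setU => /orP[/GsetP[_ xG]|/Fset_bounded[_ _ //]].
exists 1; have x1 := xG 1; rewrite (rmorph1 cst) in x1 *.
by rewrite normfV invf_le1 ?ltW // (lt_trans ltr01 x1).
Qed.

Lemma ycoord_infinitesimal (j : 'I_n) (eps : R) :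
  j \in Iset p delta :|: Gset p delta -> 0 < eps -> `|ycoord T x j| < cst eps.
Proof.
move=> jIG eps0; move: jIG; rewrite in_setU => /orP[jI|jG].
  rewrite ycoord_notin; first exact: (IsetP jI).2.
  by apply: contra (Iset_notin_GF jI); apply: (subsetP TGF).
rewrite ycoord_in ?(subsetP GT) // normfV.
have [_ xG] := GsetP jG.
have x0 : 0 < `|x j| by have := xG 0; rewrite (rmorph0 cst).
have ce0 : 0 < cst eps by rewrite -(rmorph0 cst) rcf_morph_lt.
rewrite invf_plt ?posrE // -(fmorphV cst); exact: xG.
Qed.

End Coordinates.

(** * The theorem *)

Theorem proposition3p1 (R : rcfType) (n p : nat) (delta : sper {mpoly R[n]})
    (T : {set 'I_n}) :
  (p <= n)%N ->
  (forall j : 'I_n, (j < p)%N -> nu delta 'X_j = Some 0) ->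
  (forall j : 'I_n, (p <= j)%N -> voo_lt (Some 0) (nu delta 'X_j)) ->
  Gset p delta \subset T -> T \subset Gset p delta :|: Fset p delta ->
  let dstar := psi T delta in
  let y := fun j : 'I_n => nu dstar 'X_j in
  let x := fun j : 'I_n => nu delta 'X_j in
  [/\ sper_finite dstar,
      {in Fset p delta, forall j, y j = Some 0},
      {in Iset p delta :|: Gset p delta, forall j, voo_lt (Some 0) (y j)},
      (Iset p delta :|: Gset p delta != set0 ->
         exists2 q : 'I_n, q \in Gset p delta &
         exists2 N : nat, (0 < N)%N &
           {in Iset p delta, forall j, voo_lt (y j) (voo_muln N (y q))})
      /\ (Iset p delta != set0 -> Gset p delta != set0) &
      is_localization_at_prime (sper_valring dstar)
        [pred u | phi_inv u \in sper_valring delta]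
      /\ exists phit : {additive sper_value_group dstar -> sper_value_group delta},
        [/\ (forall u : sper_field dstar,
               omap phit (valuation (sper_valring dstar) u)
               = valuation (sper_valring delta) (phi_inv u))
            /\ [/\ forall g, exists h, phit h = g,
                   {homo phit : g h / g <= h} &
                   is_isolated_subgroup [pred g | phit g == 0]],
            forall j, omap phit (y j) = x j,
            (forall j : 'I_n, (j < p)%N -> omap phit (y j) = Some 0)
            /\ (forall (j t : 'I_n) (N' : nat), (j < p)%N -> (p <= t)%N ->
                  voo_lt (voo_muln N' (y j)) (y t)) &
            forall g : {j : 'I_n | (p <= j)%N} -> sper_value_group delta,
              (forall j, x (val j) = Some (g j)) ->
              rationally_independent g ->
              exists gstar : {j : 'I_n | (p <= j)%N} -> sper_value_group dstar,
                (forall j, y (val j) = Some (gstar j)) /\ tuple_equiv gstar g]].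
Proof.
move=> _ xunit xpos GT TGF dstar y x.
pose X j := sper_eval delta 'X_j; pose Y j := sper_eval dstar 'X_j.
pose c : {rmorphism R -> sper_field delta} := sper_eval delta \o @mpolyC n R.
pose phi : {rmorphism sper_field dstar -> sper_field delta} := @phi_inv R n T delta.
have YE j : phi (Y j) = ycoord T X j by exact: phi_invX.
have ybd := ycoord_bounded xpos GT TGF.
have VP (u : sper_field dstar) : u \in sper_valring dstar <->
    exists N : R, `|phi u| <= c N by exact: psi_valringP.
have VW := psi_valring_sub ybd.
have Y0 j : (Y j == 0) = (X j == 0) by exact: (fmorph_ycoord_eq0 (YE j)).
have X0 (j : 'I_n) : (j < p)%N -> X j != 0 by move=> /xunit/valuation_eq0[].
have Yn0 (j : 'I_n) : (j < p)%N -> Y j != 0 by move=> jp; rewrite Y0 X0.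
have [phit [phitE phit_homo]] := coarsening_hom (f := phi) VW.
have Tp j : j \in T -> (j < p)%N.
  by move/(subsetP TGF); rewrite in_setU => /orP[/GsetP[]|/FsetP[]].
have xE j : omap phit (y j) = x j.
  apply: (etrans (phitE (Y j))); rewrite YE.
  by apply: valuation_ycoord => jT; apply: xunit; apply: Tp.
split.
- exact: sper_finite_psi.
- move=> j jF; have [xj0 xjb xjVb] := Fset_bounded jF.
  apply: (valuation_unit VP); rewrite YE ?ycoord_eq0 //; first exact: ybd.
  have [jT|jT] := boolP (j \in T); last by rewrite ycoord_notin.
  by rewrite ycoord_in // invrK.
- move=> j jIG; apply: (valuation_infinitesimal VP) => eps eps0.
  rewrite YE; exact: (ycoord_infinitesimal GT TGF jIG eps0).
- split=> [IG|I0]; last first.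
    have [|q qG _] := Gset_exists_dominating xunit xpos _.
      by apply: contra I0; rewrite setU_eq0 => /andP[].
    by apply/set0Pn; exists q.
  have [q qG qmax] := Gset_exists_dominating xunit xpos IG.
  have [qp qinf] := GsetP qG.
  have [k kP] := Iset_inv_growth xunit qG qmax.
  have YqV : (phi (Y q))^-1 = X q by rewrite YE ycoord_in ?(subsetP GT) ?invrK.
  exists q => //; exists k.+1 => // j jI; have jp := (IsetP jI).1.
  apply: (valuation_lt_muln VP); rewrite ?YqV ?Yn0 //.
  rewrite YE ycoord_notin; first exact: kP.
  by apply: contra (Iset_notin_GF jI); apply: (subsetP TGF).
- split; first exact: (localization_of_coarsening (f := phi) VW).
  exists phit; split.
  + split; first exact: phitE.
    split; [|exact: phit_homo|exact: coarsening_ker_isolated].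
    apply: (coarsening_surj phitE) => w.
    by have [phiV _ phiK] := phi_inv_bij T delta; exists (phiV w); apply: phiK.
  + exact: xE.
  + split=> [j jp|j t N' jp pt]; first by rewrite xE; apply: xunit.
    apply: (coarsening_ker_lt phit_homo); rewrite xE; first exact: xunit.
    exact: xpos.
  + move=> g gE; apply: (coarsening_tuple_equiv phit_homo) => j.
    by rewrite xE; apply: gE.
Qed.
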